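(* For every $n\ge 1$, the semigroup $\mathrm{Dom}_{T_n}(D_n)$ is idempotent-generated, i.e. every element of it is a finite product of idempotents belonging to $\mathrm{Dom}_{T_n}(D_n)$.
   Context: $X_n=\{1,2,\dots,n\}$ is the finite chain with its usual order, and $T_n$ is the full transformation semigroup of all maps $X_n\to X_n$, written on the right and composed left to right. $D_n=\{\alpha\in T_n: x\alpha\le x \text{ for all } x\in X_n\}$ is the subsemigroup of order-decreasing maps. For a subsemigroup $U$ of a semigroup $S$, an element $d\in S$ is dominated by $U$ if for every semigroup $T$ and all semigroup homomorphisms $f,g:S\to T$ with $f|_U=g|_U$ one has $(d)f=(d)g$; the dominion $\mathrm{Dom}_S(U)$ is the set of all elements of $S$ dominated by $U$ (a subsemigroup of $S$ containing $U$). *)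

(* Defs.v *)
From HB Require Import structures.
From mathcomp Require Import all_boot.

Set Implicit Arguments.
Unset Strict Implicit.
Unset Printing Implicit Defensive.

Local Open Scope group_scope.

(* T_n, with X_n = {1 < ... < n} encoded as 'I_n = {0 < ... < n.-1}. *)
Definition transf (n : nat) : Type := {ffun 'I_n -> 'I_n}.

HB.instance Definition _ n := Finite.on (transf n).

(* Maps act on the right: x(ab) = (xa)b. *)
Definition transf_mul n (a b : transf n) : transf n := [ffun x => b (a x)].

Fact transf_mulA n : associative (@transf_mul n).
Proof. by move=> a b c; apply/ffunP => x; rewrite !ffunE. Qed.

HB.instance Definition _ n := isSemigroup.Build (transf n) (@transf_mulA n).

Lemma transfM n (a b : transf n) (x : 'I_n) : (a * b) x = b (a x).
Proof. exact: ffunE. Qed.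

Definition decreasing (n : nat) : {pred transf n} :=
  [pred a : transf n | [forall x : 'I_n, a x <= x]].
Arguments decreasing : clear implicits.

Lemma decreasing_mulg_closed n : mulg_closed (decreasing n).
Proof.
move=> a b /forallP da /forallP db; apply/forallP => x.
by rewrite transfM (leq_trans (db _)).
Qed.

(* T ranges over associative magmas rather than over semigroupType because the
   latter also requires a choice operator on the carrier. *)
Definition dominion (S : semigroupType) (U : {pred S}) (d : S) : Prop :=
  forall T : magmaType, associative (@monoid.mul T) ->
  forall f g : {multiplicative S -> T}, {in U, f =1 g} -> f d = g d.

(* A semigroup need not have a unit, so products are non-empty: e, followed by
   the factors listed in s. *)
Definition idempotent_generated (S : semigroupType) (P : S -> Prop) : Prop :=
  forall x, P x ->
  exists e : S, exists s : seq S,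
    {in e :: s, forall y, P y /\ y * y = y} /\ x = foldl *%g e s.

(* Main.v *)
(* Writing e_ij for the idempotent sending i to j and fixing all other points,
   and 0 for the least point, the dominion consists of the identity and of the
   singular maps fixing 0.
   - A dominated map d fixes 0: decreasing maps u satisfy y (u 0) = y 0, so
     y |-> y \o u commutes with any involution that recolours the values of y
     according to y 0 alone, and this fails for d when d 0 != 0.
   - A dominated permutation is the identity: send singular maps to a zero, and
     permutations either to themselves or to 1.
   - For i != 0, e_ij is dominated, by the zigzag
     e_ij = e_ji e_ij,  e_ji = e_ij (e_i0 e_ji),  (e_i0 e_ji) e_ij = e_i0,
     e_ij e_i0 = e_ij.
   - A singular map fixing 0 is a product of such e_ij, by induction on the
     number of points that it moves. *)
From HB Require Import structures.
Require Import Defs.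
From mathcomp Require Import all_boot.

Set Implicit Arguments.
Unset Strict Implicit.
Unset Printing Implicit Defensive.

Local Open Scope group_scope.

(** * Zigzags and products in an arbitrary semigroup *)

Lemma mem_dominion (S : semigroupType) (U : {pred S}) (d : S) :
  d \in U -> dominion U d.
Proof. by move=> Ud T _ f g; apply. Qed.

(** The easy half of Isbell's zigzag theorem for a shortest zigzag: [d] is rewritten as [u * y],
    [x * v * y], [x * w], and agreement on [u], [v], [w] trades [f] for [g] along the way. *)
Lemma dominion_zigzag (S : semigroupType) (U : {pred S}) (d x u v w y : S) :
  u \in U -> v \in U -> w \in U ->
  d = u * y -> u = x * v -> v * y = w -> x * w = d -> dominion U d.
Proof.
move=> Uu Uv Uw d_uy u_xv vy_w xw_d T mulTA f g fg.
have -> : f d = g x * (g v * f y) by rewrite d_uy gmulfM fg // u_xv gmulfM mulTA.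
by rewrite -(fg v) // -gmulfM vy_w (fg w) // -gmulfM xw_d.
Qed.

Definition is_product (S : semigroupType) (P : S -> Prop) (x : S) : Prop :=
  exists e : S, exists s : seq S,
    {in e :: s, forall y, P y} /\ x = foldl *%g e s.

Lemma is_product1 (S : semigroupType) (P : S -> Prop) (x : S) :
  P x -> is_product P x.
Proof. by move=> Px; exists x, [::]; split=> // y; rewrite inE => /eqP->. Qed.

Lemma is_productM (S : semigroupType) (P : S -> Prop) (x y : S) :
  is_product P x -> is_product P y -> is_product P (x * y).
Proof.
move=> [e [s [Pes ->]]] [e' [s' [Pes' ->]]]; exists e, (s ++ e' :: s'); split.
  by move=> z; rewrite -cat_cons mem_cat => /orP[/Pes | /Pes'].
rewrite foldl_cat /=; move: (foldl _ e s) => z.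
elim/last_ind: s' {Pes'} => [|s' t IHs] //=.
by rewrite -!cats1 !foldl_cat /= mulgA IHs.
Qed.

Lemma sub_is_product (S : semigroupType) (P Q : S -> Prop) (x : S) :
  (forall y, P y -> Q y) -> is_product P x -> is_product Q x.
Proof. by move=> PQ [e [s [Pes ->]]]; exists e, s; split=> // y /Pes/PQ. Qed.

(** * Dominated permutations *)

Definition transf_id n : transf n := [ffun x => x].

Lemma decreasing_id n : transf_id n \in decreasing n.
Proof. by apply/forallP => x; rewrite ffunE. Qed.

(** By strong induction, if [a x < x] then [a] fixes [a x], so [a x] and [x] have the same image. *)
Lemma decreasing_inj n (a : transf n) :
  a \in decreasing n -> injective a -> a = transf_id n.
Proof.
move=> /forallP da inj_a; apply/ffunP => x; rewrite ffunE.
have [m] := ubnP x; elim: m x => // m IHm x /ltnSE-le_xm.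
have := da x; rewrite leq_eqVlt => /orP[/eqP/val_inj // | lt_ax].
by have /inj_a := IHm _ (leq_trans lt_ax le_xm).
Qed.

Section AdjoinZero.

Variable n : nat.

Definition transf0 : Type := option (transf n).

Definition transf0_mul (a b : transf0) : transf0 :=
  if a is Some a' then if b is Some b' then Some (a' * b') else None else None.

HB.instance Definition _ := hasMul.Build transf0 transf0_mul.

Lemma transf0_mulA : associative (@monoid.mul transf0).
Proof. by case=> [a|] [b|] [c|] //=; congr Some; apply: mulgA. Qed.

Definition units_to (h : transf n -> transf n) (a : transf n) : transf0 :=
  if injectiveb a then Some (h a) else None.

(** Finiteness gives injectivity of [b]: an injective [a] is onto, so any two points can be pulled
    back along it. *)
Lemma injectivebM (a b : transf n) :
  injectiveb (a * b) = injectiveb a && injectiveb b.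
Proof.
apply/injectiveP/andP => [inj_ab | [/injectiveP inj_a /injectiveP inj_b] x y].
  have inj_a: injective a.
    by move=> x y eq_axy; apply: inj_ab; rewrite !transfM eq_axy.
  split; apply/injectiveP => // x y.
  have [a' _ aK'] := injF_bij inj_a.
  by rewrite -[x]aK' -[y]aK' -!transfM => /inj_ab ->.
by rewrite !transfM => /inj_b/inj_a.
Qed.

Lemma units_toM (h : transf n -> transf n) :
  {morph h : a b / a * b} -> {morph units_to h : a b / a * b}.
Proof.
move=> hM a b; rewrite /units_to injectivebM.
by case: ifP => [/andP[-> ->]|]; [rewrite hM | do 2![case: ifP => // _]].
Qed.

End AdjoinZero.

Lemma dominion_decreasing_inj n (d : transf n) :
  dominion (decreasing n) d -> injective d -> d = transf_id n.
Proof.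
move=> dom_d inj_d.
pose f := units_to (@id (transf n)); pose g := units_to (fun=> transf_id n).
have fM: {morph f : a b / a * b} by apply: units_toM.
have gM: {morph g : a b / a * b}.
  by apply: units_toM => a b; apply/ffunP => x; rewrite transfM !ffunE.
pose fI := isMultiplicative.Build _ _ f fM.
pose gI := isMultiplicative.Build _ _ g gM.
pose F : {multiplicative transf n -> transf0 n} := HB.pack f fI.
pose G : {multiplicative transf n -> transf0 n} := HB.pack g gI.
have := dom_d (transf0 n) (@transf0_mulA n) F G.
rewrite /= /f /g /units_to.
have /injectiveP -> := inj_d => fg; suff [] : Some d = Some (transf_id n) by [].
apply: fg => a da /=; case: ifP => // /injectiveP inj_a.
by rewrite (decreasing_inj da inj_a).
Qed.

(** * Dominated maps fix the least point *)

Section Precomposition.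

Variable n : nat.

Definition colouring : Type := {ffun 'I_n.+1 -> option bool}.

HB.instance Definition _ := Finite.on colouring.

Definition colouring_op : Type := {ffun colouring -> colouring}.

(** The order is opposite to that of [transf_mul], because precomposition reverses the order of
    factors. *)
Definition colouring_op_mul (p q : colouring_op) : colouring_op :=
  [ffun y => p (q y)].

HB.instance Definition _ := hasMul.Build colouring_op colouring_op_mul.

Lemma colouring_op_mulA : associative (@monoid.mul colouring_op).
Proof. by move=> p q r; apply/ffunP => y; rewrite !ffunE. Qed.

Definition precomp (a : transf n.+1) (y : colouring) : colouring :=
  [ffun x => y (a x)].

Definition recolour (y : colouring) : colouring :=
  if y ord0 is None then y else [ffun x => omap negb (y x)].

(** Recolouring preserves whether [y ord0] is [None], so both applications take the same branch. *)
Lemma recolourK : involutive recolour.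
Proof.
move=> y; rewrite /recolour; case y0: (y ord0) => [b|]; last by rewrite y0.
rewrite ffunE y0 /=; apply/ffunP => x; rewrite !ffunE.
by case: (y x) => //= c; rewrite negbK.
Qed.

Lemma precomp_recolour (a : transf n.+1) (y : colouring) :
  a ord0 = ord0 -> precomp a (recolour y) = recolour (precomp a y).
Proof.
move=> a0; rewrite /recolour ffunE a0; case: (y ord0) => // _.
by apply/ffunP => x; rewrite !ffunE.
Qed.

Lemma precompM (a b : transf n.+1) (y : colouring) :
  precomp (a * b) y = precomp a (precomp b y).
Proof. by apply/ffunP => x; rewrite !ffunE. Qed.

End Precomposition.

Lemma decreasing0 n (a : transf n.+1) : a \in decreasing n.+1 -> a ord0 = ord0.
Proof. by move/forallP/(_ ord0); rewrite leqn0 => /eqP a0; apply: val_inj. Qed.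

Lemma dominion_decreasing0 n (d : transf n.+1) :
  dominion (decreasing n.+1) d -> d ord0 = ord0.
Proof.
move=> dom_d.
pose f a : colouring_op n := [ffun y => precomp a y].
pose g a : colouring_op n := [ffun y => recolour (precomp a (recolour y))].
have fM: {morph f : a b / a * b}.
  by move=> a b; apply/ffunP => y; rewrite !ffunE precompM.
have gM: {morph g : a b / a * b}.
  by move=> a b; apply/ffunP => y; rewrite !ffunE precompM recolourK.
pose fI := isMultiplicative.Build _ _ f fM.
pose gI := isMultiplicative.Build _ _ g gM.
pose F : {multiplicative transf n.+1 -> colouring_op n} := HB.pack f fI.
pose G : {multiplicative transf n.+1 -> colouring_op n} := HB.pack g gI.
have fg: {in decreasing n.+1, F =1 G}.
  move=> a /decreasing0 a0; apply/ffunP => y.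
  by rewrite !ffunE precomp_recolour // recolourK.
(* As [y] is [None] at 0, [recolour] fixes it; if [d] moved 0, [precomp d y] would be [Some false]
   at 0 and [recolour] would change it. *)
pose y : colouring n := [ffun x => if x == ord0 then None else Some false].
have /ffunP/(_ y) := dom_d _ (@colouring_op_mulA n) F G fg.
have recolour_y: recolour y = y by rewrite /recolour ffunE eqxx.
rewrite !ffunE recolour_y => /ffunP/(_ ord0).
by rewrite /recolour !ffunE; case: eqP => // _; rewrite !ffunE; case: eqP.
Qed.

(** * Idempotents moving at most one point *)

Definition collapse n (i j : 'I_n) : transf n :=
  [ffun x => if x == i then j else x].

(* Innermost tests first, so that each one compares two points. *)
Ltac case_points :=
  rewrite ?transfM !ffunE;
  repeat match goal with |- context [?x == ?y] =>
    lazymatch x with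
    | context [if _ then _ else _] => fail
    | _ => case: (x =P y) => //= ?
    end
  end; congruence.

Lemma collapse_idem n (i j : 'I_n) :
  collapse i j * collapse i j = collapse i j.
Proof. by apply/ffunP => x; case_points. Qed.

Lemma decreasing_collapse n (i j : 'I_n) :
  j <= i -> collapse i j \in decreasing n.
Proof. by move=> le_ji; apply/forallP => x; rewrite ffunE; case: eqP => // ->. Qed.

Lemma dominion_collapse n (i j : 'I_n.+1) :
  i != ord0 -> dominion (decreasing n.+1) (collapse i j).
Proof.
move=> i_neq0; have [le_ji | lt_ij] := leqP j i.
  exact/mem_dominion/decreasing_collapse.
have d_i0: collapse i ord0 \in decreasing n.+1 by apply: decreasing_collapse.
have d_ji := decreasing_collapse (ltnW lt_ij).
have ij: i <> j by move=> ij; rewrite ij ltnn in lt_ij.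
have j0: ord0 <> j by move=> j0; rewrite -j0 in lt_ij.
have i0: i <> ord0 by apply/eqP.
(* In [v], the factor [collapse i ord0] clears [i] before [j] is sent there. It has no effect after
   [collapse i j], whose image misses [i]. *)
apply: (dominion_zigzag (x := collapse i j) (y := collapse i j) d_ji
          (decreasing_mulg_closed d_i0 d_ji) d_i0);
  by apply/ffunP => x; case_points.
Qed.

(** * Factorization of singular maps fixing the least point *)

Lemma not_inj_unreached n (a : transf n) :
  ~~ injectiveb a -> exists z, forall x, a x != z.
Proof.
move=> ninj_a; case: (pickP (fun z => z \notin codom a)) => [z z_nim | sur_a].
  by exists z => x; apply: contraNneq z_nim => <-; apply: codom_f.
case/negP: ninj_a; apply/injectiveP => x y; apply: (@image_injP _ _ a 'I_n _ x y) => //.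
by apply/eqP/eq_card => z; rewrite (negbFE (sur_a z)).
Qed.

Lemma card_moved_lt n (a b : transf n) (s : 'I_n) :
  a s != s -> b s = s -> (forall x, a x = x -> b x = x) ->
  #|[pred x | b x != x]| < #|[pred x | a x != x]|.
Proof.
move=> as_neq bs fix_ab; apply: proper_card; apply/properP; split.
  by apply/subsetP => x; rewrite !inE; apply: contraNneq => /fix_ab/eqP.
by exists s; rewrite !inE // bs eqxx.
Qed.

Lemma collapse_product n (a : transf n.+1) :
  ~~ injectiveb a -> a ord0 = ord0 ->
  is_product
    (fun e => exists i j : 'I_n.+1, i != ord0 /\ e = collapse i j) a.
Proof.
set P := (X in is_product X).
have Pc i j : i != ord0 -> is_product P (collapse i j).
  by move=> i_neq0; apply: is_product1; exists i, j.
have [m] := ubnP #|[pred x | a x != x]|.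
elim: m a => // m IHm a /ltnSE-le_am ninj_a a0.
have [z nim_z] := not_inj_unreached ninj_a.
have z_neq0: z != ord0 by rewrite eq_sym -{1}a0.
have [inj_az | ] := boolP (dinjectiveb a (predC1 z)); last first.
  (* [a] is still singular after making [z] a fixed point. *)
  case/dinjectivePn => x x_neqz [y]; rewrite !inE => /andP[y_neqx y_neqz] eq_axy.
  rewrite inE in x_neqz.
  pose b : transf n.+1 := [ffun x => if x == z then z else a x].
  (* Since [a] misses [z], the last factor acts only on the image of [z] under [b]. *)
  have -> : a = b * collapse z (a z).
    apply/ffunP => t; rewrite transfM !ffunE; case: (t =P z) => [->|_].
      by rewrite eqxx.
    by rewrite (negPf (nim_z t)).
  apply: is_productM; last exact: Pc.
  apply: IHm.
  - apply: leq_trans le_am; apply: (card_moved_lt (s := z)) => //.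
      by rewrite ffunE eqxx.
    by move=> t at_t; rewrite ffunE; case: eqP => // ->.
  - apply/injectivePn; exists x, y; first by rewrite eq_sym.
    by rewrite !ffunE (negPf x_neqz) (negPf y_neqz).
  - by rewrite ffunE eq_sym (negPf z_neq0).
move/dinjectiveP: inj_az => inj_az.
(* Any collision of [a] must involve [z]. *)
have [q q_neqz aq] : exists2 q, q != z & a q = a z.
  have /injectivePn[x [y x_neqy eq_axy]] := ninj_a.
  have [xz | x_neqz] := eqVneq x z; first by exists y; rewrite -?xz // eq_sym.
  have [yz | y_neqz] := eqVneq y z; first by exists x; rewrite -?yz.
  by case/eqP: x_neqy; apply: inj_az.
have [/existsP[t /andP[t_neqz at_neqt]] | fix_a] :=
  boolP [exists t, (t != z) && (a t != t)]; last first.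
  have fixa t : t != z -> a t = t.
    move=> t_neqz; apply/eqP; apply: contraNT fix_a => at_neqt.
    by apply/existsP; exists t; rewrite t_neqz.
  have -> : a = collapse z q.
    apply/ffunP => t; rewrite ffunE; case: eqP => [->|/eqP/fixa //].
    by rewrite -aq fixa.
  exact: Pc.
(* [a] is injective off the hole [z] and moves [t] to [s]; exchanging [s] and
   [t] through the hole makes [s] fixed. *)
have [s sE] : exists s, a t = s by exists (a t).
have s_neqt: s != t by rewrite -sE.
have s_neqz: s != z by rewrite -sE.
have t_neq0: t != ord0 by apply: contraNneq s_neqt => t0; rewrite -sE t0 a0.
have s_neq0: s != ord0.
  apply: contraNneq t_neq0 => s0; apply/eqP/inj_az; rewrite ?inE //.
    by rewrite eq_sym.
  by rewrite sE s0 a0.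
have as_neqs: a s != s.
  apply: contraNneq s_neqt => as_s; apply/eqP/inj_az; rewrite ?inE //.
  by rewrite as_s sE.
(* After [collapse t s] nothing lies at [t], so the value of [b] there is free; giving it the value
   at [z] keeps [b] singular. *)
pose b : transf n.+1 :=
  [ffun x => if x == s then s else if (x == z) || (x == t) then a s else a x].
have -> : a = collapse z q * collapse s z * collapse t s * b.
  move/eqP: q_neqz t_neqz s_neqz s_neqt => ? /eqP ? /eqP ? /eqP ?.
  apply/ffunP => x; case_points.
apply: is_productM; first by apply: is_productM; [apply: is_productM|]; apply: Pc.
apply: IHm.
- apply: leq_trans le_am; apply: (card_moved_lt (s := s)) => //.
    by rewrite ffunE eqxx.
  move=> x ax; rewrite ffunE; case: eqP => // _.
  case: eqP => [xz | _] /=; first by case/eqP: (nim_z x); rewrite ax.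
  by case: eqP => // xt; case/eqP: as_neqs; rewrite -sE -xt !ax.
- apply/injectivePn; exists t, z => //.
  by rewrite !ffunE !eqxx orbT eq_sym (negPf s_neqt) eq_sym (negPf s_neqz).
- rewrite ffunE !(eq_sym ord0) (negPf s_neq0) (negPf z_neq0).
  by rewrite (negPf t_neq0) a0.
Qed.

Theorem lemma2p6 (n : nat) (n_gt0 : 0 < n) :
  idempotent_generated (dominion (decreasing n)).
Proof.
case: n n_gt0 => // n _ d dom_d.
apply: (@sub_is_product (transf n.+1)
          (fun y => dominion (decreasing n.+1) y /\ y * y = y)) => //.
have [/injectiveP inj_d | ninj_d] := boolP (injectiveb d).
  rewrite (dominion_decreasing_inj dom_d inj_d); apply: is_product1; split.
    exact/mem_dominion/decreasing_id.
  by apply/ffunP => x; rewrite transfM !ffunE.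
apply: sub_is_product (collapse_product ninj_d (dominion_decreasing0 dom_d)).
move=> _ [i [j [i_neq0 ->]]]; split; first exact: dominion_collapse.
exact: collapse_idem.
Qed.
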